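(* Let $G$ be a baseline cdf with pdf $g$ and let $a,b,m,n>0$. Put $$\beta'_j=\frac{(-1)^{j+1}}{B(m,n)\,(j+n)}\binom{m-1}{j},\qquad \beta_j=\beta'_j\,(j+n),\qquad \eta_l=\sum_{j=0}^{m-1}(-1)^l\,\beta_j\binom{j+n-1}{l}.$$ Then, for $t>0$, $$f^{BKwG}(t;a,b,m,n)=f^{KwG}(t;a,b)\sum_{l=0}^{m+n-2}\eta_l\left[F^{KwG}(t;a,b)\right]^{l}.$$
   Context: $G$ is the cdf of a baseline distribution, with pdf $g(t)=\frac{d}{dt}G(t)$, $t>0$. $B(m,n)$ is the beta function, and $\binom{x}{k}=x(x-1)\cdots(x-k+1)/k!$ is the binomial coefficient. The Kumaraswamy-$G$ distribution $Kw\text{-}G(a,b)$ has cdf $F^{KwG}(t;a,b)=1-[1-G(t)^a]^b$ and pdf $f^{KwG}(t;a,b)=ab\,g(t)G(t)^{a-1}[1-G(t)^a]^{b-1}$. The Beta Kumaraswamy-$G$ ($BKw\text{-}G$) distribution with parameters $a,b,m,n>0$ has pdf $$f^{BKwG}(t;a,b,m,n)=\frac{ab\,g(t)G(t)^{a-1}[1-G(t)^a]^{bn-1}\left[1-[1-G(t)^a]^b\right]^{m-1}}{B(m,n)},\qquad 0<t<\infty .$$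
   Formalization: The sign of β_j is corrected to β_j = −β'_j(j+n), since as printed the right side is minus the left (e.g. m = n = 1); m and n are taken to be positive integers, as the summation limits m−1 and m+n−2 require. *)

(* Defs.v *)
From HB Require Import structures.
From mathcomp Require Import all_boot all_order all_algebra.
From mathcomp Require Import all_classical all_reals all_analysis.
Set Implicit Arguments.
Unset Strict Implicit.
Unset Printing Implicit Defensive.
Import Order.TTheory GRing.Theory Num.Theory.
Import numFieldNormedType.Exports.
Local Open Scope ring_scope.

(* The library's [beta_fun] takes natural arguments only; this is Euler's
   integral for real arguments. *)
Definition betaB {R : realType} (p q : R) : R :=
  \int[@lebesgue_measure R]_(x in `]0, 1[%classic)
    (x `^ (p - 1) * (1 - x) `^ (q - 1)).

Definition binomR {R : realType} (x : R) (k : nat) : R :=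
  (\prod_(i < k) (x - i%:R)) / k`!%:R.

Definition KwG_cdf {R : realType} (G : R -> R) (a b t : R) : R :=
  1 - (1 - G t `^ a) `^ b.

Definition KwG_pdf {R : realType} (G g : R -> R) (a b t : R) : R :=
  a * b * g t * G t `^ (a - 1) * (1 - G t `^ a) `^ (b - 1).

Definition BKwG_pdf {R : realType} (G g : R -> R) (a b m n t : R) : R :=
  a * b * g t * G t `^ (a - 1) * (1 - G t `^ a) `^ (b * n - 1)
    * (1 - (1 - G t `^ a) `^ b) `^ (m - 1) / betaB m n.

(* With S = (1 - G^a)^b, the cdf of BKw-G(a, b, m, n) is
   1 + \sum_j beta'_j * S^(j + n), where
   beta'_j = (-1)^(j+1) / (B(m,n) (j + n)) * 'C(m - 1, j). *)
Definition beta' {R : realType} (m n : R) (j : nat) : R :=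
  (-1) ^+ j.+1 / (betaB m n * (j%:R + n)) * binomR (m - 1) j.

(* Differentiating S^(j + n) = (1 - F)^(j + n), with F the Kw-G cdf, gives
   - (j + n) S^(j + n - 1) f, with f the Kw-G pdf.  The minus sign is part of
   beta_j: without it, the expansion of the BKw-G pdf would have the wrong sign,
   already for m = n = 1, where BKw-G is Kw-G itself. *)
Definition beta {R : realType} (m n : R) (j : nat) : R :=
  - (beta' m n j * (j%:R + n)).

(* The range 0 <= j <= m - 1 makes sense for a positive integer m only. *)
Definition eta {R : realType} (m n l : nat) : R :=
  \sum_(0 <= j < m)
    (-1) ^+ l * beta m%:R n%:R j * binomR (j%:R + n%:R - 1) l.

(* Main.v *)
Require Import Defs.
From mathcomp Require Import all_boot all_order all_algebra.
From mathcomp Require Import all_classical all_reals all_analysis.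
From mathcomp Require Import ring.
Import Order.TTheory GRing.Theory Num.Theory.
Import numFieldNormedType.Exports.
Local Open Scope ring_scope.

(** Put [u = 1 - G t `^ a] and [S = u `^ b], so that the Kw-G cdf is [1 - S].
    Up to the common factor [a b g G^(a-1) / B(m, n)], the left-hand side is
    [u^(bn-1) (1 - S)^(m-1)].  On the right, the factor [j + n] cancels in
    [beta], and interchanging the two finite sums leaves two binomial
    expansions: the sum over [l] of [(-1)^l 'C(j+n-1, l) (1 - S)^l] is
    [S^(j+n-1)], and the sum over [j] of [(-1)^j 'C(m-1, j) S^(j+n-1)] is
    [S^(n-1) (1 - S)^(m-1)] (lemma [sum_eta]).  The identity thus reduces to
    [u^(bn-1) = u^(b-1) S^(n-1)], a law of exponents for [u > 0].

    At [u = 0] this law may fail under the convention [0 `^ 0 = 1], for instance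
    when [b n = 1] and [n > 1].  But then [G t = 1], so the cdf [G] has an
    interior maximum at [t] and [g t = 0]: both densities vanish
    (lemma [derive_eq0_at_bound]). *)

Lemma binomR_nat (R : realType) (k l : nat) :
  binomR (k%:R : R) l = 'C(k, l)%:R.
Proof.
have prodE : \prod_(i < l) (k%:R - i%:R : R) = (k ^_ l)%:R.
  elim: l => [|l IH]; first by rewrite big_ord0 ffactn0.
  rewrite big_ord_recr /= IH ffactnSr natrM.
  have [lk|kl] := leqP l k; first by rewrite natrB.
  (* beyond the degree, the falling factorial already vanishes *)
  by rewrite ffact_small// !mul0r.
by rewrite /binomR prodE -bin_ffact natrM mulfK//.
Qed.

(** The bound [N] may exceed the exponent [k]: the range of [l] can then be the
    same for all [j], as the exchange of the two sums in [sum_eta] demands. *)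
Lemma sum_sign_binomial (R : comNzRingType) (x : R) (k N : nat) :
  (k <= N)%N ->
  \sum_(0 <= l < N.+1) (-1) ^+ l * 'C(k, l)%:R * x ^+ l = (1 - x) ^+ k.
Proof.
move=> kN; rewrite exprBn (big_cat_nat (n := k.+1))//=.
rewrite [X in _ + X]big1_seq ?addr0; last first.
  move=> l /andP[_]; rewrite mem_index_iota => /andP[kl _].
  by rewrite bin_small// mulr0 mul0r.
rewrite big_mkord; apply: eq_bigr => l _.
by rewrite expr1n mulr1 -[RHS]mulr_natr; ring.
Qed.

Lemma betaE (R : realType) (m n j : nat) : (0 < m)%N -> (0 < n)%N ->
  beta (m%:R : R) n%:R j = (-1) ^+ j * 'C(m.-1, j)%:R / betaB m%:R n%:R.
Proof.
move=> m0 n0; have jn0 : (j%:R + n%:R : R) != 0.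
  by rewrite -natrD pnatr_eq0 addn_eq0 negb_and -!lt0n n0 orbT.
rewrite /beta /beta' invfM.
have -> : m%:R - 1 = m.-1%:R :> R by rewrite -subn1 natrB.
rewrite binomR_nat exprS -[LHS]opprK; set B := (betaB _ _)^-1.
by field.
Qed.

Lemma sum_eta (R : realType) (m n : nat) (S : R) : (0 < m)%N -> (0 < n)%N ->
  \sum_(0 <= l < (m + n - 2).+1) eta m n l * (1 - S) ^+ l =
  S ^+ n.-1 * (1 - S) ^+ m.-1 / betaB m%:R n%:R.
Proof.
move=> m0 n0; under eq_bigr do rewrite /eta mulr_suml.
rewrite exchange_big_nat /=.
transitivity (\sum_(0 <= j < m)
    ((-1) ^+ j * 'C(m.-1, j)%:R * S ^+ j) * (S ^+ n.-1 / betaB m%:R n%:R)).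
  apply: eq_big_nat => j /andP[_ jm].
  have E : j%:R + n%:R - 1 = (j + n.-1)%:R :> R.
    by rewrite natrD -subn1 natrB// addrA.
  (* the inner sum expands a power of [S], read as [1 - (1 - S)] *)
  transitivity (beta m%:R n%:R j * (1 - (1 - S)) ^+ (j + n.-1)); last first.
    by rewrite betaE// subKr exprD; ring.
  rewrite -(@sum_sign_binomial _ _ _ (m + n - 2)%N); last first.
    case: m n m0 n0 jm {E} => [|m] [|n]// _ _ jm.
    by rewrite addSn addnS subn2 /= leq_add2r -ltnS.
  rewrite mulr_sumr; apply: eq_bigr => l _.
  by rewrite E binomR_nat; ring.
rewrite -mulr_suml -{1}(prednK m0) sum_sign_binomial//.
by ring.
Qed.

(** Fermat's rule at an interior point where [G] attains its bound. *)
Lemma derive_eq0_at_bound (R : realType) (G g : R -> R) (t : R) :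
  (forall s, G s <= 1) -> (forall s : R, 0 < s -> is_derive s 1 G (g s)) ->
  0 < t -> G t = 1 -> g t = 0.
Proof.
move=> G1 hg t0 Gt.
have tin : t \in `]0, (t + 1)[ by rewrite in_itv /= t0 ltrDl ltr01.
have [_ <-] : is_derive t 1 G (g t) by exact: hg.
have dG : is_derive t 1 G (0 : R).
  apply: (@derive1_at_max _ G 0 (t + 1) t) => //.
  - by rewrite addr_ge0// ltW.
  - by move=> s; rewrite in_itv /= => /andP[s0 _]; have [] := hg _ s0.
  - by move=> s _; rewrite Gt.
by case: dG.
Qed.

Theorem mainTheorem2 (R : realType) (d : measure_display)
    (T : measurableType d) (P : probability T R) (X : {RV P >-> R})
    (G g : R -> R)
    (hG : forall t : R, cdf X t = (G t)%:E)
    (hg : forall t : R, 0 < t -> is_derive t 1 G (g t))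
    (a b : R) (m n : nat)
    (ha : 0 < a) (hb : 0 < b) (hm : (0 < m)%N) (hn : (0 < n)%N)
    (t : R) (ht : 0 < t) :
  BKwG_pdf G g a b m%:R n%:R t =
  KwG_pdf G g a b t *
    \sum_(0 <= l < (m + n - 2).+1) eta m n l * KwG_cdf G a b t ^+ l.
Proof.
have G0 s : 0 <= G s by rewrite -lee_fin -hG cdf_ge0.
have G1 s : G s <= 1 by rewrite -lee_fin -hG cdf_le1.
rewrite /BKwG_pdf /KwG_pdf /KwG_cdf sum_eta//.
have [Gt|Gt] := eqVneq (G t) 1.
  by rewrite (derive_eq0_at_bound _ G g t)// !(mulr0, mul0r).
have Ga1 : G t `^ a < 1.
  have -> : 1 = 1 `^ a :> R by rewrite powR1.
  rewrite gt0_ltr_powR ?nnegrE//.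
  by rewrite lt_neqAle Gt G1.
have u0 : 0 < 1 - G t `^ a by rewrite subr_gt0.
have u1 : 1 - G t `^ a <= 1 by rewrite gerBl powR_ge0.
set u := 1 - G t `^ a in u0 u1 *.
have S1 : 0 <= 1 - u `^ b.
  rewrite subr_ge0; have -> : 1 = 1 `^ b :> R by rewrite powR1.
  by apply: (ge0_ler_powR (ltW hb)); rewrite ?nnegrE// ltW.
have powR_pred (k : nat) (x : R) : (0 < k)%N -> 0 <= x ->
    x `^ (k%:R - 1) = x ^+ k.-1.
  by move=> k0 x0; rewrite -powR_mulrn// -subn1 natrB.
have -> : u `^ (b * n%:R - 1) = u `^ (b - 1) * (u `^ b) ^+ n.-1.
  rewrite -powR_pred ?powR_ge0// -powRrM -powRD; last first.
    by rewrite (gt_eqF u0) implybT.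
  by congr (_ `^ _); ring.
by rewrite powR_pred//; ring.
Qed.
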